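(* Let $V$ be a finite set (case $q=1$) or a finite-dimensional $\mathbb{F}_q$-vector space (case $q\ge 2$ a prime power) with $n=\operatorname{rk}V\ge1$. Let $H\in{V\brack n-1}$ be a hyperplane and $0\le k\le n-1$. Then $$\Psi:\mathbb{R}^{{H\brack k}}\to\mathbb{R}^{{V\brack k}},\qquad \Psi(f):K\mapsto\begin{cases}f(K)&\text{if }K\le H,\\0&\text{if }K\nleq H\end{cases}$$ is an injective $\mathbb{R}$-linear map with image $$\operatorname{im}(\Psi)=\Big\{g\in\mathbb{R}^{{V\brack k}}\ \Big|\ \operatorname{supp}g\subseteq{H\brack k}\Big\},$$ and for all $f:{H\brack k}\to\mathbb{R}$ $$\deg_V(\Psi(f))=\min(\deg_H(f)+1,\;k).$$ Moreover, for all $e\in\{\max(\deg_H(f),0)+1,\ldots,\min(k,n-k)\}$ and all $E\in{V\brack e}$, $$\operatorname{wt}^{(e)}_{\Psi(f)}(E)=\begin{cases}\displaystyle\frac{1}{[k-e+1]_q}\sum_{E'\in{E\brack e-1}}\operatorname{wt}^{(e-1)}_f(E')&\text{if }E\le H,\\[4mm]\displaystyle-\frac{[k-e]_q}{q^{k-e}\,[k-e+1]_q}\operatorname{wt}^{(e-1)}_f(E\cap H)&\text{if }E\nleq H.\end{cases}$$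
   Context: For $q=1$, ''subspaces'' of $V$ are subsets and $\operatorname{rk}U=\#U$; for $q\ge2$ they are $\mathbb{F}_q$-linear subspaces and $\operatorname{rk}U=\dim U$. $U\le W$ means inclusion. $[m]_q=1+q+\cdots+q^{m-1}$ (so $[m]_1=m$ and $[0]_q=0$). For any ambient space $W$ of rank $m$ (here $W=V$ with $m=n$, or $W=H$ with $m=n-1$), ${W\brack k}$ is the set of all subspaces of $W$ of rank $k$. For a subspace $U$ of $W$, $\boldsymbol{x}_U^{(k)}:{W\brack k}\to\mathbb{R}$ is the characteristic function of $\{K\in{W\brack k}\mid U\le K\}$. For $0\le k\le m$ and $i\in\{0,\ldots,\min(k,m-k)\}$, let $\bar V_i^{(k)}(W)\subseteq\mathbb{R}^{{W\brack k}}$ be the real span of $\{\boldsymbol{x}_I^{(k)}\mid I\in{W\brack i}\}$; this set is a basis of $\bar V_i^{(k)}(W)$ (a known fact), and these spaces form an increasing chain ending in $\mathbb{R}^{{W\brack k}}$ for $i=\min(k,m-k)$. For $f\in\bar V_i^{(k)}(W)$, the $i$-weight distribution $\operatorname{wt}_f^{(i)}:{W\brack i}\to\mathbb{R}$ is the unique function with $f=\sum_{I\in{W\brack i}}\operatorname{wt}_f^{(i)}(I)\,\boldsymbol{x}_I^{(k)}$. The degree $\deg_W(f)$ of a non-zero $f:{W\brack k}\to\mathbb{R}$ is the smallest $t\in\{0,\ldots,\min(k,m-k)\}$ with $f\in\bar V_t^{(k)}(W)$; $\deg_W(\boldsymbol 0)=-\infty$, with $-\infty+1=-\infty$. *)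

(* Defs.v *)
From HB Require Import structures.
From mathcomp Require Import all_boot all_order all_algebra.
From mathcomp Require Import reals constructive_ereal.

Set Implicit Arguments.
Unset Strict Implicit.
Unset Printing Implicit Defensive.

Import Order.TTheory GRing.Theory Num.Theory.
Local Open Scope ring_scope.

(* Gives access to the subType structure of {vspace vT}, on which the finType *)
(* structure below is built; vector.v does not provide it.                    *)
Import VectorInternalTheory.

HB.instance Definition _ (F : finFieldType) (vT : vectType F) :=
  [Countable of {vspace vT} by <:].
HB.instance Definition _ (F : finFieldType) (vT : vectType F) :=
  [Finite of {vspace vT} by <:].

(* An ambient space V: a finite set (q = 1), or a finite-dimensional vector   *)
(* space over a finite field with q elements.                                 *)
Inductive ambient : Type :=
  | SetAmbient of finType
  | VectAmbient (F : finFieldType) of vectType F.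

Definition qof (A : ambient) : nat :=
  match A with SetAmbient _ => 1 | VectAmbient F _ => #|F| end.

Definition subspace (A : ambient) : finType :=
  match A with
  | SetAmbient T => {set T}
  | VectAmbient _ vT => {vspace vT}
  end.

Definition incl (A : ambient) : rel (subspace A) :=
  match A with
  | SetAmbient T => fun U W : {set T} => U \subset W
  | VectAmbient _ vT => fun U W : {vspace vT} => (U <= W)%VS
  end.

Definition inter (A : ambient) : subspace A -> subspace A -> subspace A :=
  match A with
  | SetAmbient T => fun U W : {set T} => U :&: W
  | VectAmbient _ vT => fun U W : {vspace vT} => (U :&: W)%VS
  end.

Definition rk (A : ambient) : subspace A -> nat :=
  match A with
  | SetAmbient T => fun U : {set T} => #|U|
  | VectAmbient _ vT => fun U : {vspace vT} => \dim U
  end.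

Definition whole (A : ambient) : subspace A :=
  match A with
  | SetAmbient T => [set: T]
  | VectAmbient _ vT => fullv
  end.

Definition qint (q m : nat) : nat := (\sum_(j < m) q ^ j)%N.

(* Subspaces of W are encoded as subspaces of V contained in W.               *)
Definition gr (A : ambient) (W : subspace A) (k : nat) : {set subspace A} :=
  [set U | incl U W & rk U == k].

Notation Gr W k := {U : subspace _ | U \in gr W k}.
Notation fct R W k := {ffun Gr W k -> R^o}.

Section Functions.
Variables (R : realType) (A : ambient).
Implicit Types (W H U : subspace A) (k i : nat).

(* The value of f at U, for U in gr W k; the 0 returned for other U is a      *)
(* dummy.                                                                     *)
Definition val_at W k (f : fct R W k) U : R :=
  if insub U is Some K then f K else 0.

Definition charf W k U : fct R W k := [ffun K => (incl U (val K))%:R].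

Definition charfs W k i : #|{: Gr W i}|.-tuple (fct R W k) :=
  [tuple charf W k (val (enum_val I)) | I < #|{: Gr W i}|].

Definition Vbar W k i : {vspace fct R W k} := <<charfs W k i>>%VS.

(* For i <= minn k (rk W - k) the family charfs W k i is free, so that for f  *)
(* in Vbar W k i the function wt i f is the unique w such that f is the sum   *)
(* of the w I *: charf W k (val I).                                           *)
Definition wt W k i (f : fct R W k) : fct R W i :=
  [ffun I => coord (charfs W k i) (enum_rank I) f].

(* For k <= rk W the spaces Vbar W k t exhaust the whole function space at    *)
(* t = minn k (rk W - k), so the minimum is over a nonempty set.              *)
Definition deg W k (f : fct R W k) : \bar int :=
  if f == 0 then -oo%E
  else (val [arg min_(t < (ord_max : 'I_(minn k (rk W - k)).+1)
                    | f \in Vbar W k t) (t : nat)]%N)%:Z%:E.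

Definition Psi H k (f : fct R H k) : fct R (whole A) k :=
  [ffun K => if incl (val K) H then val_at f (val K) else 0].

End Functions.

(* Main.v *)
(* Everything rests on one count, valid for sets and for vector spaces: the    *)
(* interval [I, K] contains [rk K - rk I]_q subspaces covering I.  It gives    *)
(*   Psi(x_I) = sum of c_E x_E over the covers E of I,                         *)
(* with c_E depending only on whether E <= H, whence the weights and the bound *)
(* deg (Psi f) <= deg f + 1.                                                   *)
(* For the reverse bound write Psi f = sum of w(E) x_E over rank t < k, fix K  *)
(* of rank k in H, and sum the equations Psi f (X) = 0 over all X of rank k    *)
(* with X not in H and X /\ H <= K.  The terms with E <= H add up to a         *)
(* positive multiple of f(K), those with E not in H involve only x_(E /\ H),   *)
(* so f has degree at most t - 1.                                              *)
(* The x_E with E of rank e are independent when e <= min(k, m - k): for a     *)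
(* fixed D of rank e, summing a vanishing combination over the K of rank k     *)
(* with K /\ D = I, for each I <= D, gives a triangular system in the sums of  *)
(* the w(E) with E /\ D = I, and the sum for I = D is w(D).                    *)
Require Import Defs.
From mathcomp Require Import all_boot all_order all_algebra.
From mathcomp Require Import reals constructive_ereal.
From mathcomp Require Import finfield ring zify.

Set Implicit Arguments.
Unset Strict Implicit.
Unset Printing Implicit Defensive.

Import Order.TTheory GRing.Theory Num.Theory.
Local Open Scope ring_scope.

(** The count of covers is [card_cover]. Induction along covers extends it to [card_transverse],
    which counts the subspaces containing [U] that meet [D] no further than [U] does. This gives the
    independence [incl_indep], hence uniqueness of weights ([wt_unique]) and, with the symmetry
    [card_gr_sym], the exhaustion [Vbar_full]. [Psi_weights] writes [Psi f] with explicit weights in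
    rank i + 1: by uniqueness these are the weights claimed, and the degree rises by at most one.
    [Vbar_Psi] goes back down one rank as long as t < k, so the degree formula is capped at k. *)

Definition join (A : ambient) : subspace A -> subspace A -> subspace A :=
  match A with
  | SetAmbient T => fun U W : {set T} => U :|: W
  | VectAmbient _ vT => fun U W : {vspace vT} => (U + W)%VS
  end.

Definition bot (A : ambient) : subspace A :=
  match A with
  | SetAmbient T => set0 : {set T}
  | VectAmbient _ vT => 0%VS
  end.

(** * Arithmetic of q-integers and q-factorials *)

Definition qfact q m := (\prod_(j < m) qint q j.+1)%N.

Lemma qint_gt0 q m : (0 < q)%N -> (0 < m)%N -> (0 < qint q m)%N.
Proof. by case: m => // m q0 _; rewrite /qint big_ord_recl expn0. Qed.

Lemma qintS q m : qint q m.+1 = (qint q m + q ^ m)%N.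
Proof. by rewrite /qint big_ord_recr. Qed.

Lemma qint_geom q m : (0 < q)%N -> (qint q m * (q - 1) = q ^ m - 1)%N.
Proof.
move=> q0; elim: m => [|m IH]; first by rewrite /qint big_ord0.
rewrite qintS mulnDl IH mulnBr muln1 -expnSr addnC addnBA ?expn_gt0 ?q0 //.
by rewrite subnK // leq_pexp2l.
Qed.

Lemma leq_qint q m1 m2 : (m1 <= m2)%N -> (qint q m1 <= qint q m2)%N.
Proof.
elim: m2 => [|m2 IH]; first by rewrite leqn0 => /eqP->.
rewrite leq_eqVlt ltnS => /orP[/eqP-> //|/IH h].
by rewrite qintS (leq_trans h) // leq_addr.
Qed.

Lemma ltn_qint q m1 m2 : (0 < q)%N -> (m1 < m2)%N -> (qint q m1 < qint q m2)%N.
Proof.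
move=> q0 /(leq_qint q); apply: leq_trans.
by rewrite qintS -addn1 leq_add2l expn_gt0 q0.
Qed.

Lemma qfact_gt0 q m : (0 < q)%N -> (0 < qfact q m)%N.
Proof. by move=> q0; apply: prodn_gt0 => i; apply: qint_gt0. Qed.

Lemma qfactS q m : qfact q m.+1 = (qint q m.+1 * qfact q m)%N.
Proof. by rewrite /qfact big_ord_recr mulnC. Qed.

(** * Covers of a subspace, for vector spaces and then for sets *)

Section CoverVect.
Variables (F : finFieldType) (vT : vectType F).
Implicit Types U I K E : {vspace vT}.

(** [finvect_type vT] is [vT] viewed as a finite type, so that vectors can be counted. *)
Lemma card_vset U :
  #|[set v : finvect_type vT | (v : vT) \in U]| = (#|F| ^ \dim U)%N.
Proof.
rewrite cardsE; case: vT U => T c U.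
exact: (@card_vspace F (finvect_type (Vector.Pack c)) c U).
Qed.

Lemma card_vsetD I K : (I <= K)%VS ->
  #|[set v : finvect_type vT | ((v : vT) \in K) && ((v : vT) \notin I)]|
    = (#|F| ^ \dim K - #|F| ^ \dim I)%N.
Proof.
move=> IK; rewrite -!card_vset -cardsDS.
  by apply: eq_card => v; rewrite !inE andbC.
by apply/subsetP=> v; rewrite !inE; apply: (subvP IK).
Qed.

(** Every vector of K outside I spans a cover with I, and each cover arises from q^(dim I + 1) -
    q^(dim I) vectors. Summing these fibres gives q^(dim K) - q^(dim I). *)
Lemma card_cover_vect I K : (I <= K)%VS ->
  #|[set E : {vspace vT} |
       [&& (I <= E)%VS, (E <= K)%VS & \dim E == (\dim I).+1]]|
    = qint #|F| (\dim K - \dim I).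
Proof.
move=> IK; set P := [set E | _].
have q1 : (1 < #|F|)%N by exact: finNzRing_gt1.
have fib E : E \in P ->
  #|[set v : finvect_type vT |
       ((v : vT) \in K) && ((v : vT) \notin I) & (I + <[v : vT]>)%VS == E]|
   = (#|F| ^ (\dim I).+1 - #|F| ^ \dim I)%N.
  rewrite inE => /and3P[IE EK /eqP dE]; rewrite -dE -(card_vsetD IE).
  apply: eq_card => v; rewrite !inE; apply/idP/idP.
    move=> /andP[/andP[_ ->] /eqP<-]; rewrite andbT.
    by rewrite (subvP (addvSr _ _)) // memv_line.
  move=> /andP[vE vI]; rewrite (subvP EK) //= vI /= eqEdim subv_add IE -memvE vE.
  by rewrite /= dE (ltn_leqif (dimv_leqif_sup (addvSl _ _))) subv_add subvv -memvE.
have q0 : (0 < #|F| ^ \dim I * (#|F| - 1))%N by rewrite muln_gt0 expn_gt0; lia.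
apply/eqP; rewrite -(eqn_pmul2r q0); apply/eqP.
have qE : (#|F| ^ \dim I * (#|F| - 1) = #|F| ^ (\dim I).+1 - #|F| ^ \dim I)%N.
  by rewrite mulnBr muln1 expnSr.
rewrite {1}qE.
rewrite -sum_nat_const -(eq_bigr _ fib).
rewrite (eq_bigr _ (fun E _ => esym (sum1dep_card _))).
rewrite -(partition_big (fun v : finvect_type vT => (I + <[v : vT]>)%VS)
  (mem P)) /=.
  rewrite sum1dep_card card_vsetD // -{1}(subnK (dimvS IK)) expnD mulnCA.
  by rewrite qint_geom ?(ltnW q1) // mulnBr muln1 mulnC.
move=> v /andP[vK vI]; rewrite inE addvSl subv_add IK -memvE vK /=.
rewrite eqn_leq (ltn_leqif (dimv_leqif_sup (addvSl _ _))) subv_add subvv -memvE.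
rewrite (negPf vI) andbT (leq_trans (dimv_add_leqif _ _)) // dim_vline.
by case: (_ != _); lia.
Qed.
End CoverVect.

(** The covers are the sets [x |: I] for x in [K :\: I], each obtained from one x. *)
Lemma card_cover_set (T : finType) (I K : {set T}) : I \subset K ->
  #|[set E : {set T} | [&& I \subset E, E \subset K & #|E| == #|I|.+1]]|
    = qint 1 (#|K| - #|I|).
Proof.
move=> IK; rewrite /qint (eq_bigr (fun=> 1%N)) => [|i _]; last by rewrite exp1n.
rewrite sum1_card card_ord -cardsDS //.
rewrite -(@card_in_imset _ _ (fun x => x |: I) (mem (K :\: I))).
  apply: eq_card => E; rewrite !inE; apply/idP/imsetP.
    move=> /and3P[IE EK /eqP cE].
    have /cards1P[x Ex] : #|E :\: I| == 1%N by rewrite cardsDS // cE subSnn.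
    have : x \in E :\: I by rewrite Ex inE.
    rewrite inE => /andP[xI xE]; exists x; first by rewrite inE xI (subsetP EK).
    by rewrite -Ex setUC -{1}(setIidPr IE) setID.
  move=> [x]; rewrite inE => /andP[xI xK] ->.
  by rewrite subsetUr subUset sub1set xK IK cardsU1 xI add1n eqxx.
move=> x y; rewrite !inE => /andP[xI _] /andP[yI _] /setP/(_ x).
by rewrite /= !inE eqxx (negPf xI) !orbF => /esym/eqP.
Qed.

(** * The rank lattice of subspaces; beyond this section sets and vector spaces are no longer
    distinguished *)

Section Lattice.
Variable A : ambient.
Implicit Types U W X Y I K E D H : subspace A.
Local Notation q := (qof A).

Lemma qof_gt0 : (0 < q)%N.
Proof. by case: A => //= F vT; apply/card_gt0P; exists 0. Qed.

Lemma incl_refl U : incl U U.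
Proof. by case: A U => [T|F vT] U /=. Qed.

Lemma incl_trans W U X : incl U W -> incl W X -> incl U X.
Proof.
by case: A U W X => [T|F vT] U W X /=; [exact: subset_trans|exact: subv_trans].
Qed.

Lemma incl_rk_eq U W : incl U W -> (rk W <= rk U)%N -> U = W.
Proof.
case: A U W => [T|F vT] U W /= UW r; apply/eqP; last by rewrite eqEdim UW r.
by rewrite eqEcard UW r.
Qed.

Lemma rk_le U W : incl U W -> (rk U <= rk W)%N.
Proof.
by case: A U W => [T|F vT] U W /=; [exact: subset_leq_card|exact: dimvS].
Qed.

Lemma incl_anti U W : incl U W -> incl W U -> U = W.
Proof. by move=> UW /rk_le; apply: incl_rk_eq. Qed.

Lemma incl_inter X U W : incl X (inter U W) = incl X U && incl X W.
Proof.
by case: A X U W => [T|F vT] X U W /=; [exact: subsetI|exact: subv_cap].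
Qed.

Lemma join_incl U W X : incl (join U W) X = incl U X && incl W X.
Proof.
by case: A X U W => [T|F vT] X U W /=; [exact: subUset|exact: subv_add].
Qed.

Lemma incl_interl U W : incl (inter U W) U.
Proof. by have := incl_refl (inter U W); rewrite incl_inter => /andP[]. Qed.

Lemma incl_interr U W : incl (inter U W) W.
Proof. by have := incl_refl (inter U W); rewrite incl_inter => /andP[]. Qed.

Lemma incl_joinl U W : incl U (join U W).
Proof. by have := incl_refl (join U W); rewrite join_incl => /andP[]. Qed.

Lemma incl_joinr U W : incl W (join U W).
Proof. by have := incl_refl (join U W); rewrite join_incl => /andP[]. Qed.

Lemma rk_join U W : (rk (join U W) + rk (inter U W) = rk U + rk W)%N.
Proof.
case: A U W => [T|F vT] U W /=; last exact: dimv_sum_cap.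
by rewrite cardsUI.
Qed.

Lemma incl_whole U : incl U (whole A).
Proof. by case: A U => [T|F vT] U /=; [exact: subsetT|exact: subvf]. Qed.

Lemma bot_incl U : incl (bot A) U.
Proof. by case: A U => [T|F vT] U /=; [exact: sub0set|exact: sub0v]. Qed.

Lemma rk_bot : rk (bot A) = 0%N.
Proof. by case: A => [T|F vT] /=; [exact: cards0|exact: dimv0]. Qed.

Lemma card_cover I K : incl I K ->
  #|[set E | [&& incl I E, incl E K & rk E == (rk I).+1]]|
  = qint q (rk K - rk I).
Proof.
by case: A I K => [T|F vT] I K /=; [exact: card_cover_set|exact: card_cover_vect].
Qed.

Lemma inter_eq U W : incl U W -> inter U W = U.
Proof.
by move=> UW; apply: incl_anti; rewrite ?incl_interl // incl_inter incl_refl.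
Qed.

End Lattice.

(** * Counting subspaces with a prescribed intersection *)

Section Count.
Variable A : ambient.
Implicit Types U W X Y I J K E D H : subspace A.
Local Notation q := (qof A).

Lemma interC U W : inter U W = inter W U.
Proof.
by apply: incl_anti; rewrite incl_inter incl_interl incl_interr.
Qed.

Lemma inter_mono U X D : incl U X -> incl (inter U D) (inter X D).
Proof.
by move=> UX; rewrite incl_inter incl_interr (incl_trans (incl_interl _ _) UX).
Qed.

Lemma join_mono U X D : incl U X -> incl (join U D) (join X D).
Proof.
by move=> UX; rewrite join_incl incl_joinr (incl_trans UX (incl_joinl _ _)).
Qed.

Lemma join_eq U W : incl W U -> join U W = U.
Proof.
by move=> WU; apply: incl_anti; rewrite ?incl_joinl // join_incl incl_refl.
Qed.

(** The modular law: one inclusion is formal, and the rank identity [rk_join] makes the ranks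
    agree. *)
Lemma join_inter E I D : incl I D ->
  inter (join E I) D = join (inter E D) I.
Proof.
move=> ID; apply/esym/incl_rk_eq.
  by rewrite join_incl inter_mono ?incl_joinl // incl_inter ID incl_joinr.
have h1 := rk_join (join E I) D; have h2 := rk_join (inter E D) I.
have h3 := rk_join E I; have h4 := rk_join E D.
have e1 : join (join E I) D = join E D.
  apply: incl_anti; last by apply: join_mono; apply: incl_joinl.
  by rewrite !join_incl incl_joinl incl_joinr (incl_trans ID) // incl_joinr.
have e2 : inter (inter E D) I = inter E I.
  apply: incl_anti; first by apply: inter_mono; apply: incl_interl.
  rewrite !incl_inter incl_interl incl_interr (incl_trans _ ID) //.
  by rewrite incl_interr.
by rewrite e1 in h1; rewrite e2 in h2; lia.
Qed.

(** By [rk_join] the extra rank of X goes either to the join with D or to the intersection with D,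
    never to both. *)
Lemma cover_inter U X D : incl U X -> rk X = (rk U).+1 ->
  (inter X D == inter U D) = ~~ incl X (join U D).
Proof.
move=> UX rX; have h1 := rk_join U D; have h2 := rk_join X D.
apply/eqP/idP => [e|nX].
  apply/negP => XUD.
  have e2 : join X D = join U D.
    by apply: incl_anti (join_mono D UX); rewrite join_incl XUD incl_joinr.
  by rewrite e e2 in h2; lia.
apply/esym/incl_rk_eq; first exact: inter_mono.
have := join_mono D UX => UDXD; rewrite leqNgt; apply/negP => lt.
have e : join U D = join X D by apply: incl_rk_eq => //; lia.
by move: nX; rewrite e incl_joinl.
Qed.

(** Induction on d, counting pairs of a K and a cover X of U inside K. Such an X keeps the
    intersection with D, so it is a cover of U not inside [join U D]. Passing from U to X leaves the
    rank of the join with D relative to the base unchanged, so the subtracted term is the same in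
    all factors. *)
Lemma card_transverse W D d U : incl U W -> incl D W ->
  (#|[set K | [&& incl U K, incl K W, rk K == (rk U + d)%N &
                  inter K D == inter U D]]| * qfact q d
   = \prod_(j < d) (qint q (rk W - rk U - j) - qint q (rk (join U D) - rk U)))%N.
Proof.
move=> UW DW; elim: d U UW => [|d IH] U UW.
  rewrite big_ord0 /qfact big_ord0 muln1; apply/eqP/cards1P; exists U.
  apply/setP=> K; rewrite !inE addn0; apply/idP/eqP => [|->].
    by move=> /and4P[UK _ /eqP rK _]; apply/esym/incl_rk_eq; rewrite // rK.
  by rewrite incl_refl UW !eqxx.
set S := fun U d => [set K | [&& incl U K, incl K W, rk K == (rk U + d)%N &
                  inter K D == inter U D]].
rewrite -/(S U d.+1); set r := rk (join U D).
set C := [set X | [&& incl U X, incl X W & rk X == (rk U).+1]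
                  && ~~ incl X (join U D)].
have UDW : incl (join U D) W by rewrite join_incl UW.
have cC : #|C| = (qint q (rk W - rk U) - qint q (r - rk U))%N.
  rewrite -(card_cover UW) -(card_cover (incl_joinl U D)) -cardsDS.
    apply: eq_card => X; rewrite !inE.
    by case: (incl U X); case: (incl X W); case: (rk X == _); case: (incl X _).
  apply/subsetP=> X; rewrite !inE => /and3P[-> XUD ->].
  by rewrite (incl_trans XUD).
(* Each K contains [qint q d.+1] covers of U, all of them in C. *)
have cnt : (#|S U d.+1| * qint q d.+1 = \sum_(X in C) #|S X d|)%N.
  rewrite -sum_nat_const.
  rewrite (eq_bigr (fun K =>
     \sum_(X | [&& incl U X, incl X K & rk X == (rk U).+1]) 1)%N); last first.
    move=> K; rewrite inE => /and4P[UK _ /eqP rK _].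
    by rewrite sum1dep_card card_cover // rK addKn.
  rewrite (exchange_big_dep (mem C)) /=; last first.
    move=> K X; rewrite !inE => /and4P[UK KW rK /eqP iK] /and3P[UX XK /eqP rX].
    rewrite UX (incl_trans XK KW) rX eqxx /= -cover_inter //; apply/eqP.
    by apply: incl_anti (inter_mono D UX); rewrite -iK inter_mono.
  apply: eq_bigr => X; rewrite inE => /andP[/and3P[UX XW /eqP rX]].
  rewrite -cover_inter // => /eqP iX.
  rewrite sum1dep_card; apply: eq_card => K.
  rewrite !inE rX iX addSnnS UX eqxx andbT /=.
  by case XK: (incl X K); rewrite ?andbF ?andbT //= (incl_trans UX XK).
rewrite qfactS mulnA cnt big_distrl big_ord_recl /= subn0 -cC -sum_nat_const.
apply: eq_bigr => X; rewrite inE => /andP[/and3P[UX XW /eqP rX] nX].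
rewrite IH //; have h1 := rk_join U D; have h2 := rk_join X D.
move: nX; rewrite -cover_inter // => /eqP iX; rewrite iX rX in h2.
apply: eq_bigr => j _; rewrite rX /bump /=; congr (qint _ _ - qint _ _)%N; lia.
Qed.

(* [ext m u s k] counts the rank-[k] subspaces [K] of a rank-[m] space that    *)
(* contain a rank-[u] subspace [U] and satisfy [inter K D = inter U D], where  *)
(* [s] is the rank of [join U D] relative to [U].                              *)
Definition ext m u s k : nat :=
  if (u <= k)%N then
    ((\prod_(j < k - u) (qint q (m - u - j) - qint q s)) %/ qfact q (k - u))%N
  else 0%N.

(** The division in [ext] is exact by [card_transverse]. *)
Lemma card_ext W D U k : incl U W -> incl D W ->
  #|[set K | [&& incl U K, incl K W, rk K == k & inter K D == inter U D]]|
  = ext (rk W) (rk U) (rk (join U D) - rk U) k.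
Proof.
move=> UW DW; rewrite /ext; case: leqP => [uk|ku].
  rewrite -{1}(subnKC uk) -card_transverse // mulnK // qfact_gt0 //.
  exact: qof_gt0.
apply/eqP; rewrite cards_eq0; apply/eqP/setP => K; rewrite !inE.
by apply/negP => /and4P[/rk_le + _ /eqP rK _]; lia.
Qed.

Lemma qfact_prod m d : (d <= m)%N ->
  (\prod_(j < d) qint q (m - j) * qfact q (m - d) = qfact q m)%N.
Proof.
elim: d => [|d IH] dm; first by rewrite big_ord0 mul1n subn0.
rewrite big_ord_recr /= -mulnA -IH ?(ltnW dm) //; congr muln.
by rewrite -(subnSK dm) qfactS.
Qed.

(** The Gaussian binomial, in product form: take D = I in [card_transverse], where the intersection
    condition is void and the subtracted term is 0. *)
Lemma card_interval I K d : incl I K -> (d <= rk K - rk I)%N ->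
  (#|[set X | [&& incl I X, incl X K & rk X == (rk I + d)%N]]| * qfact q d
     * qfact q (rk K - rk I - d) = qfact q (rk K - rk I))%N.
Proof.
move=> IK dle; rewrite -(qfact_prod dle); congr muln.
rewrite -[RHS](eq_bigr _ (fun j _ => subn0 _)).
have := card_transverse d IK IK.
have -> : qint q (rk (join I I) - rk I) = 0%N.
  by rewrite join_eq ?incl_refl // subnn /qint big_ord0.
move<-; congr muln; apply: eq_card => X; rewrite !inE.
case IX: (incl I X) => //=; rewrite (inter_eq (incl_refl I)) interC inter_eq //.
by rewrite eqxx andbT.
Qed.

Lemma card_hyperplanes I K : incl I K -> (rk I < rk K)%N ->
  #|[set X | [&& incl I X, incl X K & rk X == (rk K).-1]]|
  = qint q (rk K - rk I).
Proof.
move=> IK lt; have d1 : ((rk K - rk I).-1 <= rk K - rk I)%N by lia.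
have := card_interval IK d1.
have -> : (rk I + (rk K - rk I).-1 = (rk K).-1)%N by lia.
have -> : (rk K - rk I - (rk K - rk I).-1 = 1)%N by lia.
have -> : qfact q (rk K - rk I) = (qint q (rk K - rk I) * qfact q (rk K - rk I).-1)%N.
  have : (0 < rk K - rk I)%N by lia.
  by case: (rk K - rk I)%N => // d _; rewrite qfactS.
rewrite {2}/qfact big_ord1 /qint big_ord1 expn0 muln1 => /eqP.
by rewrite eqn_pmul2r ?qfact_gt0 ?qof_gt0 // => /eqP.
Qed.

Lemma card_gr_sym W k : (k <= rk W)%N -> #|gr W (rk W - k)| = #|gr W k|.
Proof.
have gen d : (d <= rk W)%N ->
    (#|gr W d| * qfact q d * qfact q (rk W - d) = qfact q (rk W))%N.
  move=> dW; have := @card_interval (bot A) W d (bot_incl W).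
  rewrite rk_bot subn0 => /(_ dW) <-; congr (_ * _ * _)%N.
  by apply: eq_card => X; rewrite !inE bot_incl add0n.
move=> kW; have := gen _ (leq_subr k (rk W)); rewrite -(gen _ kW) subKn //.
move/eqP; rewrite -!mulnA [(qfact _ k * _)%N]mulnC.
by rewrite eqn_pmul2r ?muln_gt0 ?qfact_gt0 ?qof_gt0 // => /eqP.
Qed.

(** * Independence of the characteristic functions *)

Section Indep.
Variable R : numDomainType.

Lemma incl_indep W k e (w : subspace A -> R) :
    (e <= k)%N -> (e + k <= rk W)%N ->
    (forall K, K \in gr W k -> \sum_(E in gr W e) w E * (incl E K)%:R = 0) ->
  forall D, D \in gr W e -> w D = 0.
Proof.
move=> ek ekW w0 D; rewrite inE => /andP[DW /eqP rD].
suff claim r I : (rk I < r)%N -> incl I D ->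
    \sum_(E in gr W e | inter E D == I) w E = 0.
  have := claim _ D (ltnSn _) (incl_refl D); rewrite (big_pred1 D) // => E /=.
  rewrite inE; apply/idP/eqP => [|->]; last by rewrite DW rD inter_eq ?incl_refl ?eqxx.
  move=> /andP[/andP[EW /eqP rE] /eqP iE]; apply/esym/incl_rk_eq; last by rewrite rD rE.
  by rewrite -iE incl_interl.
elim: r I => // r IH I rI ID.
have IW := incl_trans ID DW.
(* The number of K containing E with [inter K D] equal to I depends on E only through J =
   [inter E D]: it counts extensions of [join E I], of rank e + rk I - rk J, and vanishes unless J
   is inside I. *)
pose c J := if incl J I then
  ext (rk W) (e + rk I - rk J) (e - rk I) k else 0%N.
have cP E : E \in gr W e ->
    #|[set K in gr W k | (inter K D == I) && incl E K]| = c (inter E D).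
  rewrite inE /c => /andP[EW /eqP rE]; case: ifPn => iE.
    have h1 := rk_join E I; have h2 := rk_join E D.
    have h3 := rk_join (join E I) D.
    have e1 : inter E I = inter E D.
      by apply: incl_anti; rewrite incl_inter ?incl_interl ?iE //=
        (incl_trans (incl_interr _ _) ID).
    have e2 : inter (join E I) D = I.
      rewrite join_inter //; apply: incl_anti; last exact: incl_joinr.
      by rewrite join_incl iE incl_refl.
    have -> : (e + rk I - rk (inter E D) = rk (join E I))%N by rewrite -e1; lia.
    have -> : (e - rk I = rk (join (join E I) D) - rk (join E I))%N.
      by rewrite e2 in h3; lia.
    rewrite -card_ext ?join_incl ?EW //; apply: eq_card => K.
    rewrite !inE e2 join_incl.
    have [iK|] := eqVneq (inter K D) I; last by rewrite !andbF.
    have -> : incl I K by rewrite -iK incl_interl.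
    by rewrite !andbT [LHS]andbC.
  apply/eqP; rewrite cards_eq0; apply/eqP/setP => K; rewrite !inE.
  apply/negP => /andP[_ /andP[/eqP iK EK]]; case/negP: iE.
  by rewrite -iK inter_mono.
have : \sum_(K in gr W k | inter K D == I)
    \sum_(E in gr W e) w E * (incl E K)%:R = 0.
  by apply: big1 => K /andP[KW _]; apply: w0.
rewrite exchange_big /=.
rewrite (eq_bigr (fun E => w E * (c (inter E D))%:R)); last first.
  move=> E /cP <-; rewrite -mulr_sumr; congr (_ * _).
  rewrite -sum1_card natr_sum big_mkcond /= [RHS]big_mkcond /=.
  apply: eq_bigr => K _; rewrite [in RHS]inE.
  by case: (K \in gr W k) => //=; case: (_ == I) => //=; case: (incl E K).
rewrite (partition_big (fun E => inter E D) xpredT) //= (bigD1 I) //=.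
(* Triangularity: for J other than I, either c J = 0, or J is properly inside I and the induction
   hypothesis applies. *)
rewrite [X in _ + X]big1 ?addr0; last first.
  move=> J JI.
  rewrite (eq_bigr (fun E => w E * (c J)%:R)) => [|E /andP[_ /eqP->] //].
  rewrite -mulr_suml /c; case: ifPn => [incJ|]; last by rewrite mulr0.
  rewrite IH ?mul0r ?(incl_trans incJ ID) //.
  have /negP : ~ (rk I <= rk J)%N by move=> h; case/eqP: JI; apply: incl_rk_eq.
  by lia.
rewrite (eq_bigr (fun E => w E * (c I)%:R)) => [|E /andP[_ /eqP->] //].
rewrite -mulr_suml => /eqP; rewrite mulf_eq0 => /orP[/eqP //|].
(* If c I = 0, no E meets D in I: for such an E every factor in [card_transverse] is positive
   because e + k <= rk W, so some K would exist. *)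
rewrite pnatr_eq0 => /eqP cI0; apply: big1 => E /andP[EW /eqP iE]; exfalso.
have := cP E EW; rewrite iE cI0; move: EW; rewrite inE => /andP[EW /eqP rE].
have := card_transverse (k - e) EW DW; rewrite rE subnKC // => + c0.
suff -> : #|[set K | [&& incl E K, incl K W, rk K == k
                         & inter K D == inter E D]]| = 0%N.
  rewrite mul0n => /esym/eqP; apply/negP; rewrite -lt0n prodn_gt0 // => j.
  have h := rk_join E D; rewrite subn_gt0 ltn_qint ?qof_gt0 //.
  by have := ltn_ord j; move: h; rewrite iE; lia.
rewrite -[RHS]c0; apply: eq_card => K; rewrite !inE iE.
by case: (incl E K); rewrite ?andbF ?andbT //= andbA.
Qed.

End Indep.
End Count.

(** * Weight distributions, the chain of spaces [Vbar], and the degree *)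

Section Weights.
Variables (R : realType) (A : ambient).
Implicit Types (U W X Y I J K E D H : subspace A) (w : subspace A -> R).
Local Notation q := (qof A).

Lemma mem_gr W k U : (U \in gr W k) = incl U W && (rk U == k).
Proof. by rewrite inE. Qed.

Lemma Gr_incl W k (K : Gr W k) : incl (val K) W.
Proof. by case: K => K /=; rewrite mem_gr => /andP[]. Qed.

Lemma Gr_rk W k (K : Gr W k) : rk (val K) = k.
Proof. by case: K => K /=; rewrite mem_gr => /andP[_ /eqP]. Qed.

Lemma val_at_val W k (f : fct R W k) (K : Gr W k) : val_at f (val K) = f K.
Proof. by rewrite /val_at valK. Qed.

(** Passes from tuple indices to sums over subspaces. Weights are total functions on [subspace A]
    from here on, which avoids dependent indices. *)
Lemma sum_charfs W k i w (K : Gr W k) :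
  (\sum_(j < #|{: Gr W i}|) w (val (enum_val j)) *: (charfs R W k i)`_j) K
  = \sum_(I in gr W i) w I * (incl I (val K))%:R.
Proof.
rewrite sum_ffunE.
under eq_bigr => j _ do rewrite -tnth_nth tnth_mktuple !ffunE.
rewrite [RHS]big_sub [RHS](reindex (@enum_val _ {: Gr W i})) //=.
exact/onW_bij/enum_val_bij.
Qed.

Lemma VbarP W k i (f : fct R W k) : f \in Vbar R W k i ->
  forall K : Gr W k,
    f K = \sum_(I in gr W i) val_at (wt i f) I * (incl I (val K))%:R.
Proof.
move=> /coord_span fE K; rewrite {1}fE -sum_charfs; congr (fun_of_fin _ K).
by apply: eq_bigr => j _; rewrite val_at_val ffunE enum_valK.
Qed.

Lemma eq_sum_charfs W k i w (f : fct R W k) :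
    (forall K : Gr W k, f K = \sum_(I in gr W i) w I * (incl I (val K))%:R) ->
  f = \sum_(j < #|{: Gr W i}|) w (val (enum_val j)) *: (charfs R W k i)`_j.
Proof. by move=> fE; apply/ffunP => K; rewrite sum_charfs. Qed.

Lemma sum_Vbar W k i w (f : fct R W k) :
    (forall K : Gr W k, f K = \sum_(I in gr W i) w I * (incl I (val K))%:R) ->
  f \in Vbar R W k i.
Proof.
move/eq_sum_charfs ->; apply: memv_suml => j _; apply/memvZ/memv_span.
by rewrite mem_nth // size_tuple.
Qed.

Lemma free_charfs W k i : (i <= k)%N -> (i + k <= rk W)%N ->
  free (charfs R W k i).
Proof.
move=> ik ikW; apply/freeP => c c0 j.
pose g : fct R W i := [ffun I => c (enum_rank I)].
have cE j' : c j' = val_at g (val (enum_val j')).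
  by rewrite val_at_val ffunE enum_valK.
rewrite cE; apply: (incl_indep ik ikW); last exact: valP.
move=> K KW; rewrite -(sum_charfs i (val_at g) (exist _ K KW : Gr W k)).
under eq_bigr => j' _ do rewrite -cE.
by rewrite c0 ffunE.
Qed.

Lemma wt_unique W k i w (f : fct R W k) : (i <= k)%N -> (i + k <= rk W)%N ->
    (forall K : Gr W k, f K = \sum_(I in gr W i) w I * (incl I (val K))%:R) ->
  forall I : Gr W i, wt i f I = w (val I).
Proof.
move=> ik ikW /eq_sum_charfs fE I; rewrite ffunE fE coord_sum_free ?free_charfs //.
by rewrite enum_rankK.
Qed.

Lemma card_Gr W k : #|{: Gr W k}| = #|gr W k|.
Proof. by rewrite card_sig; apply: eq_card => U; rewrite inE. Qed.

(** Dimension count: the free family has as many members as there are K, trivially if i = k and by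
    [card_gr_sym] if i = rk W - k. *)
Lemma Vbar_full W k (f : fct R W k) : (k <= rk W)%N ->
  f \in Vbar R W k (minn k (rk W - k)).
Proof.
move=> kW; set i := minn _ _.
suff -> : Vbar R W k i = fullv by rewrite memvf.
have ik : (i <= k)%N by rewrite geq_minl.
have ikW : (i + k <= rk W)%N by rewrite /i; lia.
apply/eqP; rewrite eqEdim subvf /= dimvf.
have /eqP -> := free_charfs ik ikW; rewrite size_tuple card_Gr.
have -> : #|gr W i| = #|gr W k|.
  by rewrite /i; case: leqP => _ //; rewrite card_gr_sym.
by rewrite /dim /= card_Gr muln1.
Qed.

Lemma natr_card_sum (T : finType) (P Q : pred T) :
  \sum_(x | P x) (Q x)%:R = #|[set x | P x && Q x]|%:R :> R.
Proof.
rewrite -sum1dep_card natr_sum big_mkcondr /=.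
by apply: eq_bigr => x _; case: (Q x).
Qed.

(** x_I is the sum of x_E over the covers E of I, divided by [k - i]_q, since each K containing I
    contains [k - i]_q of them. *)
Lemma Vbar_succ W k i (f : fct R W k) : (i < k)%N ->
  f \in Vbar R W k i -> f \in Vbar R W k i.+1.
Proof.
move=> ik /VbarP fE; set w := val_at _ in fE.
have q0 : (qint q (k - i))%:R != 0 :> R.
  by rewrite pnatr_eq0 -lt0n qint_gt0 ?qof_gt0 // subn_gt0.
apply: (@sum_Vbar _ _ _
  (fun E => \sum_(I in gr W i | incl I E) w I / (qint q (k - i))%:R)).
move=> K; rewrite fE.
under [RHS]eq_bigr => E _ do rewrite mulr_suml big_mkcondr /=.
rewrite exchange_big /=; apply: eq_bigr => I; rewrite mem_gr => /andP[IW /eqP rI].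
transitivity (w I / (qint q (k - i))%:R *
  \sum_(E in gr W i.+1) (incl I E && incl E (val K))%:R).
  rewrite natr_card_sum; case IK: (incl I (val K)).
    suff -> : #|[set E | (E \in gr W i.+1) && (incl I E && incl E (val K))]|
        = qint q (k - i) by rewrite mulr1 divfK.
    have := card_cover IK; rewrite (Gr_rk K) rI => <-; apply: eq_card => E; rewrite !inE.
    case IE: (incl I E); case EK: (incl E (val K)); rewrite ?andbF ?andbT //=.
    by rewrite (incl_trans EK (Gr_incl K)).
  rewrite (_ : [set E | _] = set0) ?cards0 ?mulr0 //; apply/setP=> E; rewrite !inE.
  by apply/negP => /andP[_ /andP[h /(incl_trans h)]]; rewrite IK.
rewrite mulr_sumr; apply: eq_bigr => E _.
by case: (incl I E) => //=; rewrite ?mulr0 ?mul0r.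
Qed.

Lemma Vbar_mono W k i j (f : fct R W k) : (i <= j)%N -> (j <= k)%N ->
  f \in Vbar R W k i -> f \in Vbar R W k j.
Proof.
move=> ij jk fi; rewrite -(subnKC ij) in jk *.
elim: (j - i)%N jk => [|d IH] dk; first by rewrite addn0.
by rewrite addnS in dk *; apply: Vbar_succ => //; apply/IH/ltnW.
Qed.

Lemma degP W k (f : fct R W k) : (k <= rk W)%N -> f != 0 ->
  exists d : nat, [/\ deg f = d%:Z%:E, (d <= minn k (rk W - k))%N,
    f \in Vbar R W k d &
    forall t, (t <= minn k (rk W - k))%N -> f \in Vbar R W k t -> (d <= t)%N].
Proof.
move=> kW f0; rewrite /deg (negPf f0).
case: arg_minnP => [|d fd dmin]; first exact: Vbar_full.
exists d; split=> //; first by rewrite -ltnS.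
by move=> t; rewrite -ltnS => lt ft; apply: (dmin (Ordinal lt)).
Qed.

End Weights.

(** * Extension by zero from a hyperplane: weights and degree bounds *)

Section Hyperplane.
Variables (R : realType) (A : ambient) (H : subspace A).
Hypothesis rkH : (rk H).+1 = rk (whole A).
Implicit Types (U W X Y I J K E D : subspace A) (w : subspace A -> R).
Local Notation q := (qof A).
Local Notation V := (whole A).

Lemma rk_inter_hyperplane K : ~~ incl K H -> rk K = (rk (inter K H)).+1.
Proof.
move=> KH; have h := rk_join K H; have h1 := rk_le (incl_whole (join K H)).
have : (rk (join K H) <> rk H)%N; last first.
  by have := rk_le (incl_joinr K H); lia.
move=> e; case/negP: KH; rewrite (incl_rk_eq (incl_joinr K H)) ?e //.
exact: incl_joinl.
Qed.

(** Sort the X by Y = [inter X H], a subspace of K of rank k - 1 containing [inter E H]. If E is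
    inside H, the X over Y are the covers of Y not in H, numbering [n-k+1]_q - [n-k]_q = q^(n-k)
    with n the rank of V. Otherwise X must be [join Y E]. *)
Lemma card_lift k K E : K \in gr H k -> (rk E < k)%N ->
  #|[set X in gr V k | [&& ~~ incl X H, incl (inter X H) K & incl E X]]|
  = (if incl E H then incl E K * (qint q (k - rk E) * q ^ (rk V - k))
     else incl (inter E H) K * qint q (k - rk E).+1)%N.
Proof.
rewrite inE => /andP[KH /eqP rK] Ek; set L := [set X in _ | _].
pose P := [set Y | [&& incl (inter E H) Y, incl Y K & rk Y == k.-1]].
have kn : (k < rk V)%N by rewrite -rkH ltnS -rK rk_le.
have k0 : k = k.-1.+1 by rewrite prednK //; apply: leq_ltn_trans Ek.
have -> : (#|L| = \sum_(Y in P) #|[set X in L | inter X H == Y]|)%N.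
  rewrite -sum1_card (partition_big (fun X => inter X H) (mem P)) /=.
    by apply: eq_bigr => Y _; rewrite sum1dep_card.
  move=> X; rewrite !inE => /and4P[/andP[_ /eqP rX] XH XK EX].
  by rewrite XK inter_mono //= -eqSS -rk_inter_hyperplane // rX -k0.
have cP : #|P| = (incl (inter E H) K * qint q (k - rk (inter E H)))%N.
  case iK: (incl (inter E H) K).
    rewrite mul1n -[in RHS]rK -card_hyperplanes // ?rK //.
    exact: leq_ltn_trans (rk_le (incl_interl _ _)) Ek.
  apply/eqP; rewrite mul0n cards_eq0; apply/eqP/setP => Y; rewrite !inE.
  by apply/negP => /and3P[h /(incl_trans h)]; rewrite iK.
case: ifPn => EH; [rewrite (eq_bigr (fun=> (q ^ (rk V - k))%N))|
                   rewrite (eq_bigr (fun=> 1%N))].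
- rewrite sum_nat_const cP inter_eq // mulnA; reflexivity.
- move=> Y; rewrite inE inter_eq // => /and3P[EY YK /eqP rY].
  have YH := incl_trans YK KH.
  have -> : [set X in L | inter X H == Y] =
     [set X | [&& incl Y X, incl X V & rk X == (rk Y).+1]] :\:
     [set X | [&& incl Y X, incl X H & rk X == (rk Y).+1]].
    apply/setP => X; rewrite !inE incl_whole rY -k0 /=; apply/idP/idP.
      move=> /andP[/and4P[-> XH _ _] /eqP <-].
      by rewrite incl_interl (negPf XH) andbF.
    move=> /andP[+ /andP[YX rX]]; rewrite YX rX andbT /= => XH.
    have <- : Y = inter X H.
      apply: incl_rk_eq; first by rewrite incl_inter YX.
      by rewrite -ltnS -rk_inter_hyperplane // rY -k0 (eqP rX).
    by rewrite XH YK (incl_trans EY YX) eqxx.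
  rewrite cardsDS ?card_cover ?incl_whole //; last first.
    by apply/subsetP => X; rewrite !inE incl_whole => /and3P[-> _ ->].
  have -> : (rk V - rk Y = (rk V - k).+1)%N by lia.
  have -> : (rk H - rk Y = rk V - k)%N by lia.
  by rewrite qintS addKn.
- have := rk_inter_hyperplane EH => rE; rewrite sum_nat_const cP.
  have -> : (k - rk E).+1 = (k - rk (inter E H))%N by lia.
  exact: muln1.
- move=> Y; rewrite inE => /and3P[EY YK /eqP rY].
  have YH := incl_trans YK KH; have rE := rk_inter_hyperplane EH.
  have JH : ~~ incl (join Y E) H by rewrite join_incl negb_and EH orbT.
  have iYE : inter Y E = inter E H.
    apply: incl_anti; rewrite incl_inter ?incl_interl ?incl_interr //=.
      exact: incl_trans (incl_interl _ _) YH.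
    by rewrite EY ?incl_interl.
  have rJ : rk (join Y E) = k by have := rk_join Y E; rewrite iYE; lia.
  apply/eqP/cards1P; exists (join Y E); apply/setP => X; rewrite !inE incl_whole /=.
  apply/idP/eqP => [/andP[/and4P[/eqP rX XH _ EX] /eqP iX]|->].
    by apply/esym/incl_rk_eq; rewrite ?rJ ?rX // join_incl EX -iX incl_interl.
  have <- : Y = inter (join Y E) H.
    apply: incl_rk_eq; first by rewrite incl_inter incl_joinl.
    by rewrite -ltnS -rk_inter_hyperplane // rJ rY -k0.
  by rewrite rJ JH YK incl_joinr !eqxx.
Qed.

(** The weight of a cover E of I in [Psi] of x_I, for I of rank i in H. The first value makes the
    sum 1 on K inside H; the second makes covers outside H cancel those inside when K is not in
    H. *)
Definition coeff k i E : R :=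
  if incl E H then (qint q (k - i))%:R^-1
  else - ((qint q (k - i.+1))%:R / ((q ^ (k - i.+1))%:R * (qint q (k - i))%:R)).

Lemma sum_coeff k i I K : I \in gr H i -> K \in gr V k -> (i < k)%N ->
  \sum_(E in gr V i.+1) coeff k i E * (incl I E && incl E K)%:R
  = (incl I K && incl K H)%:R.
Proof.
rewrite !inE => /andP[IH /eqP rI] /andP[_ /eqP rK] ik.
have q0 : (qint q (k - i))%:R != 0 :> R.
  by rewrite pnatr_eq0 -lt0n qint_gt0 ?qof_gt0 // subn_gt0.
have qe0 : (q ^ (k - i.+1))%:R != 0 :> R by rewrite pnatr_eq0 -lt0n expn_gt0 qof_gt0.
case IK: (incl I K); last first.
  apply: big1 => E _; case: andP => [[IE EK]|_]; last by rewrite mulr0.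
  by rewrite (incl_trans IE EK) in IK.
set a := (qint q (k - i))%:R^-1 : R.
set b := (qint q (k - i.+1))%:R
  / ((q ^ (k - i.+1))%:R * (qint q (k - i))%:R) : R.
have IKH : incl I (inter K H) by rewrite incl_inter IK IH.
pose C := [set E | [&& incl I E, incl E K & rk E == (rk I).+1]].
pose CH := [set E | [&& incl I E, incl E (inter K H) & rk E == (rk I).+1]].
have cC : #|C| = qint q (k - i) by rewrite card_cover // rK rI.
have cCH : #|CH| = qint q (rk (inter K H) - i) by rewrite card_cover // rI.
have CHC : CH \subset C.
  apply/subsetP => E; rewrite !inE => /and3P[-> h ->].
  by rewrite (incl_trans h (incl_interl _ _)).
(* If K is not in H, [inter K H] contains [k-i-1]_q covers of I, and the remaining q^(k-i-1) covers
   in K lie outside H. *)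
have -> : \sum_(E in gr V i.+1) coeff k i E * (incl I E && incl E K)%:R
    = a *+ #|CH| - b *+ #|C :\: CH|.
  rewrite (bigID (fun E => incl E H)) /=; congr (_ + _).
    rewrite -sumr_const big_mkcond [RHS]big_mkcond /=; apply: eq_bigr => E _.
    rewrite !inE rI incl_whole incl_inter /coeff -/a.
    case: (incl E H); case: (rk E == _); case: (incl I E); case: (incl E K);
      by rewrite //= ?mulr1 ?mulr0.
  rewrite -mulNrn -sumr_const big_mkcond [RHS]big_mkcond /=; apply: eq_bigr => E _.
  rewrite !inE rI incl_whole incl_inter /coeff -/b.
  case: (incl E H); case: (rk E == _); case: (incl I E); case: (incl E K);
    by rewrite //= ?mulr1 ?mulr0.
rewrite cardsDS // cC cCH; case KH: (incl K H).
  by rewrite inter_eq // rK subnn mulr0n subr0 -[LHS]mulr_natr mulVf.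
have := rk_inter_hyperplane (negbT KH); rewrite rK => kE.
have -> : (rk (inter K H) - i = k - i.+1)%N by lia.
have -> : (qint q (k - i) - qint q (k - i.+1) = q ^ (k - i.+1))%N.
  by rewrite -(subnSK ik) qintS addKn.
apply/eqP; rewrite subr_eq0 -[eqbLHS]mulr_natr -[eqbRHS]mulr_natr /a /b; apply/eqP.
by field; rewrite q0 qe0.
Qed.

Lemma Psi_weights k i w (f : fct R H k) : (i < k)%N ->
    (forall K : Gr H k, f K = \sum_(I in gr H i) w I * (incl I (val K))%:R) ->
  forall K : Gr V k, Psi f K = \sum_(E in gr V i.+1)
     (coeff k i E * \sum_(I in gr H i | incl I E) w I) * (incl E (val K))%:R.
Proof.
move=> ik fE K.
transitivity (\sum_(I in gr H i) w I * (incl I (val K) && incl (val K) H)%:R).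
  rewrite ffunE; case: ifPn => KH; last first.
    by rewrite big1 // => I _; rewrite andbF mulr0.
  have KgrH : val K \in gr H k by rewrite inE KH Gr_rk eqxx.
  rewrite (val_at_val f (exist _ (val K) KgrH : Gr H k)) fE.
  by apply: eq_bigr => I _; rewrite andbT.
under eq_bigr => I Ii do rewrite -(sum_coeff Ii (valP K) ik) mulr_sumr.
rewrite exchange_big /=; apply: eq_bigr => E _.
rewrite mulr_sumr mulr_suml [RHS]big_mkcondr /=; apply: eq_bigr => I _.
by case: (incl I E) => /=; [rewrite mulrA [w I * _]mulrC|rewrite !mulr0].
Qed.

Lemma Psi_Vbar k i (f : fct R H k) : (i < k)%N ->
  f \in Vbar R H k i -> Psi f \in Vbar R V k i.+1.
Proof. by move=> ik /VbarP/(Psi_weights ik)/sum_Vbar. Qed.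

(** The weight of an E outside H is moved to [inter E H], of rank t - 1. For t = 0 no such E exists,
    which forces f = 0. *)
Lemma Vbar_Psi k t (f : fct R H k) : (t < k)%N -> Psi f \in Vbar R V k t ->
  if t is t'.+1 then f \in Vbar R H k t' else f = 0.
Proof.
move=> tk Pt.
suff [w' fK] : exists w' : subspace A -> R, forall K : Gr H k,
    f K = \sum_(E in gr V t | ~~ incl E H) w' E * (incl (inter E H) (val K))%:R.
  case: t tk Pt fK => [|t] tk _ fK.
    apply/ffunP => K; rewrite fK ffunE big_pred0 // => E; rewrite inE.
    apply/negP => /andP[/andP[_ /eqP rE]] /rk_inter_hyperplane.
    by rewrite rE.
  apply: (@sum_Vbar _ _ _ _ _
    (fun I => \sum_(E in gr V t.+1 | ~~ incl E H && (inter E H == I)) w' E)) => K.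
  rewrite fK (partition_big (fun E => inter E H) (mem (gr H t))) /=; last first.
    move=> E /andP[]; rewrite !inE incl_interr => /andP[_ /eqP rE] /rk_inter_hyperplane.
    by rewrite rE => -[->]; rewrite eqxx.
  apply: eq_bigr => I _; rewrite mulr_suml; apply: eq_big => E.
    by rewrite andbA.
  by move=> /andP[_ /eqP->].
move: Pt => /VbarP; set w := val_at _ => fE.
(* The multiplicity from [card_lift] for E inside H, independent of E and nonzero because t < k. *)
pose C1 := (qint q (k - t) * q ^ (rk V - k))%N.
have C10 : C1%:R != 0 :> R.
  rewrite pnatr_eq0 -lt0n muln_gt0 expn_gt0 qof_gt0 qint_gt0 ?qof_gt0 //.
  by rewrite subn_gt0.
pose w' E := - (w E * (qint q (k - t).+1)%:R / C1%:R).
exists w' => K.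
have : \sum_(X in gr V k | ~~ incl X H && incl (inter X H) (val K))
    \sum_(E in gr V t) w E * (incl E X)%:R = 0.
  apply: big1 => X /andP[XV /andP[XH _]].
  by have := fE (exist _ X XV); rewrite ffunE /= (negPf XH) => <-.
rewrite exchange_big /=.
rewrite (eq_bigr (fun E => w E *
    (if incl E H then (incl E (val K) * C1)%N
     else (incl (inter E H) (val K) * qint q (k - t).+1)%N)%:R)); last first.
  move=> E; rewrite inE => /andP[_ /eqP rE]; rewrite -mulr_sumr; congr (_ * _).
  have Ek : (rk E < k)%N by rewrite rE.
  have := card_lift (valP K) Ek; rewrite rE -/C1 => <-.
  rewrite natr_card_sum; congr (_%:R).
  apply: eq_card => X; rewrite !inE.
  by case: (incl E X); rewrite ?andbF ?andbT.
rewrite (bigID (fun E => incl E H)) /= => /eqP; rewrite addrC addr_eq0 => /eqP e.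
(* As K is inside H, its subspaces E are too, so C1 times f K is exactly the part of the summed
   equation with E inside H. *)
have KV : val K \in gr V k by rewrite inE incl_whole Gr_rk eqxx.
have := fE (exist _ (val K) KV); rewrite ffunE /= Gr_incl val_at_val => ->.
apply: (mulIf C10).
transitivity (\sum_(E in gr V t | incl E H) w E *
    (if incl E H then (incl E (val K) * C1)%N
     else (incl (inter E H) (val K) * qint q (k - t).+1)%N)%:R).
  rewrite mulr_suml [RHS]big_mkcondr /=; apply: eq_bigr => E _.
  case EH: (incl E H); first by rewrite natrM mulrA.
  case EK: (incl E (val K)); last by rewrite mulr0 mul0r.
  by rewrite (incl_trans EK (Gr_incl K)) in EH.
apply: oppr_inj; rewrite -e -mulNr -sumrN mulr_suml; apply: eq_bigr => E /andP[_ EH].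
rewrite (negPf EH) /w' natrM; field; exact: C10.
Qed.

End Hyperplane.

(** * Assembling the theorem *)

Lemma gr_whole (A : ambient) (W U : subspace A) k :
  U \in gr W k -> U \in gr (whole A) k.
Proof. by rewrite !inE incl_whole => /andP[]. Qed.

Lemma Psi_Gr (R : realType) (A : ambient) (H : subspace A) k (f : fct R H k)
    (K : Gr H k) : Psi f (exist _ (val K) (gr_whole (valP K))) = f K.
Proof. by rewrite ffunE /= Gr_incl val_at_val. Qed.

(** The alternative and the witness K' are chosen before f, so they serve several functions at once,
    as linearity requires. *)
Lemma Psi_cases (R : realType) (A : ambient) (H : subspace A) k
    (K : Gr (whole A) k) :
  (forall f : fct R H k, Psi f K = 0) \/
  (exists K' : Gr H k, forall f : fct R H k, Psi f K = f K').
Proof.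
case KH: (incl (val K) H); last by left=> f; rewrite ffunE KH.
right; have KgrH : val K \in gr H k by rewrite inE KH Gr_rk eqxx.
pose K' : Gr H k := exist _ (val K) KgrH.
by exists K' => f; rewrite ffunE KH (val_at_val f K').
Qed.

Lemma Psi_linear (R : realType) (A : ambient) (H : subspace A) k :
  linear (@Psi R A H k).
Proof.
move=> a f g; apply/ffunP => K; rewrite [RHS]ffunE [X in _ = X + _]ffunE.
case: (Psi_cases R H K) => [Psi0|[K' PsiK]].
  by rewrite !Psi0 scaler0 addr0.
by rewrite !PsiK !ffunE.
Qed.

Lemma Psi_inj (R : realType) (A : ambient) (H : subspace A) k :
  injective (@Psi R A H k).
Proof. by move=> f g fg; apply/ffunP => K; rewrite -[LHS]Psi_Gr fg Psi_Gr. Qed.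

Lemma deg_Psi (R : realType) (A : ambient) (H : subspace A) k (f : fct R H k) :
    (rk H).+1 = rk (whole A) -> (k <= rk H)%N ->
  deg (Psi f) = mine (deg f + 1)%E k%:Z%:E.
Proof.
move=> rkH kH; have [->|f0] := eqVneq f 0.
  have -> : Psi (0 : fct R H k) = 0.
    by apply/ffunP => K; case: (Psi_cases R H K) => [->|[K' ->]]; rewrite !ffunE.
  by rewrite /deg !eqxx /= minElt ltNye.
have kV : (k <= rk (whole A))%N by rewrite -rkH leqW.
have Pf0 : Psi f != 0.
  apply: contra_neq f0 => Pf0; apply: Psi_inj; rewrite Pf0; apply/ffunP => K.
  by case: (Psi_cases R H K) => [->|[K' ->]]; rewrite !ffunE.
have [d [-> dle fd dmin]] := degP kH f0.
have [e [-> ele Pfe emin]] := degP kV Pf0.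
rewrite -EFinD -EFin_min; congr (_%:E).
have ek : (e <= k)%N by lia.
(* The bounds [up] and [low] determine e: if e < k they give e = d + 1, and if e = k then d + 1 >=
   k. *)
have up : (d < k)%N -> (e <= d.+1)%N.
  move=> dk; apply: emin; first by lia.
  exact: Psi_Vbar.
have low : (e < k)%N -> (d < e)%N.
  move=> lt; have := Vbar_Psi rkH lt Pfe.
  case: e {Pfe emin up} ele ek lt => [|e] ele ek lt.
    by move=> f00; rewrite f00 eqxx in f0.
  by move=> fe; rewrite ltnS; apply: dmin => //; lia.
lia.
Qed.

Lemma wt_Psi (R : realType) (A : ambient) (H : subspace A) k i (f : fct R H k) :
    (rk H).+1 = rk (whole A) -> (i < k)%N -> (i.+1 + k <= rk (whole A))%N ->
    f \in Vbar R H k i -> forall E : Gr (whole A) i.+1,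
  wt i.+1 (Psi f) E = coeff R H k i (val E)
    * \sum_(I in gr H i | incl I (val E)) val_at (wt i f) I.
Proof.
move=> rkH ik ikV /VbarP/(Psi_weights rkH ik) PfE E.
by rewrite (wt_unique ik ikV PfE).
Qed.

Theorem theorem6p4 (R : realType) (A : ambient) (q n k : nat)
    (H : subspace A)
    (hq : q = qof A) (hn : n = rk (whole A)) (hn1 : (1 <= n)%N)
    (hH : H \in gr (whole A) n.-1) (hk : (k <= n.-1)%N) :
  [/\ linear (@Psi R A H k),
      injective (@Psi R A H k),
      (forall g : fct R (whole A) k,
         (exists f : fct R H k, Psi f = g) <->
         (forall K, K \in support g -> val K \in gr H k)),
      (forall f : fct R H k,
         deg (Psi f) = mine (deg f + 1)%E k%:Z%:E) &
      (forall (f : fct R H k) (e : nat),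
         (maxe (deg f) 0 + 1 <= e%:Z%:E)%E -> (e <= minn k (n - k))%N ->
         forall E : Gr (whole A) e,
           wt e (Psi f) E =
           if incl (val E) H then
             (qint q (k - e + 1))%:R^-1 *
               \sum_(E' in gr (val E) e.-1) val_at (wt e.-1 f) E'
           else
             - ((qint q (k - e))%:R
                / ((q ^ (k - e))%:R * (qint q (k - e + 1))%:R)) *
               val_at (wt e.-1 f) (inter (val E) H))].
Proof.
have rkH : (rk H).+1 = rk (whole A).
  by move: hH; rewrite inE => /andP[_ /eqP ->]; rewrite -hn prednK.
have rkHn : rk H = n.-1 by rewrite hn -rkH.
have kH : (k <= rk H)%N by rewrite rkHn.
split; [exact: Psi_linear|exact: Psi_inj| |by move=> f; exact: deg_Psi|].
- move=> g; split=> [[f <-] K|gH].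
    rewrite !inE Gr_rk eqxx andbT ffunE; case: ifP => // _.
    by rewrite eqxx.
  (* The preimage is the restriction of g to the subspaces of H. *)
  exists [ffun K => g (exist _ (val K) (gr_whole (valP K)))].
  apply/ffunP => K; rewrite ffunE; case: ifPn => KH.
    have KgrH : val K \in gr H k by rewrite inE KH Gr_rk eqxx.
    rewrite (val_at_val _ (exist _ (val K) KgrH : Gr H k)) ffunE; congr (g _).
    exact: val_inj.
  apply/esym/eqP; apply: contraNT KH => gK; move: (gH K).
  by rewrite inE gK => /(_ isT); rewrite inE => /andP[].
move=> f e he ek E.
(* The lower bound on e says that deg f is at most e - 1; for f = 0 it still gives e >= 1, through
   the maximum with 0. *)
have [e0 fe] : (0 < e)%N /\ f \in Vbar R H k e.-1.
  have [f0|f0] := eqVneq f 0.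
    split; last by rewrite f0 mem0v.
    by move: he; rewrite f0 /deg eqxx; case: e {ek E}.
  have [d [dE dle fd _]] := degP kH f0.
  have de : (d < e)%N.
    move: he; rewrite dE -EFin_max -EFinD lee_fin; lia.
  by split; [lia|apply: Vbar_mono fd; lia].
case: e e0 fe ek E {he} => // i _ fi ik E.
have ikk : (i < k)%N by lia.
rewrite wt_Psi //; last by lia.
have -> : (k - i.+1 + 1 = k - i)%N by lia.
rewrite /coeff -hq; case: ifPn => EH; congr (_ * _).
  apply: eq_bigl => I; rewrite !inE.
  case IE: (incl I (val E)); last by rewrite andbF.
  by rewrite (incl_trans IE EH) andbT.
have rE := rk_inter_hyperplane rkH EH; rewrite Gr_rk in rE.
(* For E outside H, the only subspace of rank e - 1 inside both E and H is their intersection. *)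
rewrite (big_pred1 (inter (val E) H)) // => I /=; rewrite inE.
apply/idP/eqP => [/andP[/andP[IH /eqP rI] IE]|->].
  by apply: incl_rk_eq; [rewrite incl_inter IE|rewrite rI; case: rE => <-].
by rewrite incl_interr incl_interl andbT /=; case: rE => <-.
Qed.
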